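(* Let $T>0$ and, for $n\in\mathbb{N}$, let $\psi_n(v)=\left(2^n n!\sqrt{\pi T}\right)^{-1/2}H_n\!\left(\frac{v}{\sqrt T}\right)e^{-v^2/T}$. For $m,n\ge 0$ let $a_{mn}=\int_{\mathbb{R}}\psi_m(v)\psi_n(v)\,dv$. If $m+n$ is odd, then $a_{mn}=0$. Otherwise $$a_{mn}=(-1)^{\frac{m-n}{2}}\,2^{-(m+n)-\frac12}\,\frac{(m+n)!}{\left(\frac{m+n}{2}\right)!\,\sqrt{m!\,n!}}.$$
   Context: $\mathbb{N}$ contains $0$. $H_n$ denotes the (physicists') Hermite polynomial of degree $n$, with positive leading coefficient, orthogonal with respect to $e^{-v^2}$: $\int_{\mathbb{R}}H_n(v)H_m(v)e^{-v^2}\,dv=\sqrt{\pi}\,2^m m!\,\delta_{n,m}$. The functions $\psi_n$ are called scaled asymmetrically-weighted Hermite functions, and $A=(a_{mn})_{m,n\ge0}$ is their infinite Gram matrix for the standard (unweighted) $L^2(\mathbb{R})$ inner product. *)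

(* Defs.v *)
From HB Require Import structures.
From mathcomp Require Import all_boot all_order all_algebra.
From mathcomp Require Import all_classical all_reals all_analysis.

Set Implicit Arguments.
Unset Strict Implicit.
Unset Printing Implicit Defensive.

Import Order.TTheory GRing.Theory Num.Theory.
Import numFieldNormedType.Exports.

Local Open Scope ring_scope.

(* H is the sequence of physicists' Hermite polynomials; these conditions
   determine H uniquely.  The integral takes values in the extended reals, so
   its being a real number includes integrability. *)
Definition is_hermite (R : realType) (H : nat -> {poly R}) : Prop :=
  [/\ forall n, size (H n) = n.+1,
      forall n, 0 < lead_coef (H n)
    & forall n m,
        (\int[lebesgue_measure]_(v in setT)
           ((H n).[v] * (H m).[v] * expR (- v ^+ 2))%:E)%E =
        (if n == m then Num.sqrt pi * 2 ^+ m * m`!%:R else 0)%:E].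

Definition psi (R : realType) (H : nat -> {poly R}) (T : R) (n : nat) (v : R)
    : R :=
  (2 ^+ n * n`!%:R * Num.sqrt (pi * T)) `^ (- 2^-1) *
  (H n).[v / Num.sqrt T] * expR (- (v ^+ 2 / T)).

Definition gram (R : realType) (H : nat -> {poly R}) (T : R) (m n : nat)
    : \bar R :=
  (\int[lebesgue_measure]_(v in setT) (psi H T m v * psi H T n v)%:E)%E.

(* Main.v *)
Require Import Defs.
From HB Require Import structures.
From mathcomp Require Import all_boot all_order all_algebra.
From mathcomp Require Import all_classical all_reals all_analysis.
From mathcomp Require Import measurable_realfun.
From mathcomp Require Import ring lra zify.

Set Implicit Arguments.
Unset Strict Implicit.
Unset Printing Implicit Defensive.

Import Order.TTheory GRing.Theory Num.Theory.
Import numFieldNormedType.Exports.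

Local Open Scope ring_scope.

(* Write h_{n+1} = 2 X h_n - h_n'.  Integration by parts against exp(-v^2)
   gives int h_n q exp(-v^2) = int q^(n) exp(-v^2), so the h_n satisfy the
   orthogonality relations, which characterise them: H = h.  After rescaling
   v by sqrt T the Gram integrals involve the weight exp(-2 v^2), i.e. a
   linear form M with M(p') = M(4 X p).  The operator q |-> 2 X q - q' is then
   skew for M, hence M(h_m h_n) = (-1)^m M(h_{m+n}), and
   M(h_{n+2}) = -(n+1) M(h_n) evaluates the right-hand side. *)

(** * Hermite polynomials from the raising recurrence: derivative, degree, leading coefficient *)

Fixpoint hermite (R : nzRingType) (n : nat) : {poly R} :=
  if n is n'.+1 then 2%:P * 'X * hermite R n' - (hermite R n')^`() else 1.

(** Induction: differentiating 2 X h_{n+1} - h_{n+1}' gives 2 h_{n+1} plus 2(n+1) times 2 X h_n -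
    h_n', and the latter is again h_{n+1}. *)
Lemma deriv_hermiteS (R : comNzRingType) (n : nat) :
  (hermite R n.+1)^`() = (2 * n.+1)%:R *: hermite R n.
Proof.
elim: n => [|n IH].
  by rewrite /= derivB mulr1 derivM !derivC derivX mul0r subr0 add0r mulr1 -mul_polyC mulr1.
have -> : hermite R n.+2 = 2%:P * 'X * hermite R n.+1 - (hermite R n.+1)^`() by [].
rewrite derivB !derivM derivC derivX IH derivZ /= -!mul_polyC.
rewrite !natrM !polyCM !polyC_natr -addn1 !natrD.
ring.
Qed.

Lemma size_hermite_leq (R : comNzRingType) (n : nat) : (size (hermite R n) <= n.+1)%N.
Proof.
elim: n => [|n IH] /=; first by rewrite size_poly1.
apply/leq_sizeP => j hj; have /leq_sizeP H := IH.
rewrite coefB coef_deriv -mulrA mulrCA coefXM coefCM.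
by case: j hj => // j hj /=; rewrite !H ?mulr0 ?mul0rn ?subr0 //; lia.
Qed.

Lemma coef_hermite (R : comNzRingType) (n : nat) : (hermite R n)`_n = 2 ^+ n.
Proof.
elim: n => [|n IH] /=; first by rewrite coef1.
have /leq_sizeP H := size_hermite_leq R n.
by rewrite coefB coef_deriv -mulrA mulrCA coefXM coefCM /= IH H // mul0rn subr0 exprS.
Qed.

Lemma derivn_coef (R : nzRingType) (n : nat) (q : {poly R}) :
  (size q <= n.+1)%N -> q^`(n) = (q`_n *+ n`!)%:P.
Proof.
move=> /leq_sizeP hq; apply/polyP => -[|i]; rewrite coef_derivn coefC /=.
  by rewrite addn0 ffactnn.
by rewrite hq ?mul0rn //; lia.
Qed.

(** * Orthogonality and uniqueness for a functional obeying integration by parts against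
    exp(-v^2) *)

Section Orthogonal.
Variables (R : realFieldType) (L : {scalar {poly R}}).
Hypothesis Lderiv : forall p, L p^`() = L (2%:P * 'X * p).

(** The product rule turns each raising step on the left factor into a derivative on q, up to 2 X (h
    q) - (h q)', which [L] annihilates. *)
Lemma hermite_rodrigues (n : nat) (q : {poly R}) : L (hermite R n * q) = L q^`(n).
Proof.
elim: n q => [|n IH] q /=; first by rewrite mul1r.
have -> : (2%:P * 'X * hermite R n - (hermite R n)^`()) * q =
  2%:P * 'X * (hermite R n * q) - (hermite R n * q)^`() + hermite R n * q^`().
  by rewrite derivM; ring.
by rewrite linearD linearB /= (Lderiv (hermite R n * q)) subrr add0r IH -derivSn.
Qed.

Lemma hermite_orthogonal (n : nat) (q : {poly R}) :
  (size q <= n.+1)%N -> L (hermite R n * q) = q`_n * n`!%:R * L 1.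
Proof.
move=> hq; rewrite hermite_rodrigues derivn_coef // -[in LHS](mulr1 (_%:P)).
by rewrite mul_polyC linearZ /= mulr_natr.
Qed.

Lemma hermite_unique (H : nat -> {poly R}) :
  0 < L 1 -> (forall n, size (H n) = n.+1) -> (forall n, 0 < lead_coef (H n)) ->
  (forall n m, n != m -> L (H n * H m) = 0) ->
  (forall n, L (H n * H n) = 2 ^+ n * n`!%:R * L 1) ->
  H =1 hermite R.
Proof.
move=> L1 sH lH oH nH n.
have orth k (q : {poly R}) : (k <= n)%N -> (size q <= k)%N -> L (H n * q) = 0.
  elim: k q => [|k IH] q kn.
    by rewrite leqn0 size_poly_eq0 => /eqP ->; rewrite mulr0 linear0.
  (* Removing a multiple of [H k] cancels the coefficient of degree k, so the rest falls under the
     induction hypothesis. *)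
  move=> sq; pose a := q`_k / lead_coef (H k).
  have -> : q = a *: H k + (q - a *: H k) by ring.
  rewrite mulrDr linearD /= -scalerAr linearZ /= oH; last by lia.
  rewrite mulr0 add0r IH //; first by lia.
  apply/leq_sizeP => j; rewrite leq_eqVlt => /predU1P[<-|kj].
    rewrite coefB coefZ /a lead_coefE sH /= divfK ?subrr //.
    by have := lH k; rewrite lead_coefE sH /= => /lt0r_neq0.
  rewrite coefB coefZ; have /leq_sizeP -> // : (size q <= j)%N by lia.
  by have /leq_sizeP -> // : (size (H k) <= j)%N; rewrite ?sH // mulr0 subrr.
have two_neq0 k : 2 ^+ k != 0 :> R by rewrite expf_neq0 // pnatr_eq0.
(* This ratio of leading coefficients makes the difference [r] drop in degree; it remains to show
   [r = 0] and [a = 1]. *)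
pose a := lead_coef (H n) / 2 ^+ n.
have a0 : 0 < a by rewrite divr_gt0 // exprn_gt0.
pose r := H n - a *: hermite R n.
have sr : (size r <= n)%N.
  apply/leq_sizeP => j; rewrite leq_eqVlt => /predU1P[<-|nj].
    by rewrite coefB coefZ coef_hermite /a lead_coefE sH /= divfK // subrr.
  rewrite coefB coefZ; have /leq_sizeP -> // : (size (H n) <= j)%N by rewrite sH.
  have /leq_sizeP -> // : (size (hermite R n) <= j)%N.
    exact: leq_trans (size_hermite_leq R n) nj.
  by rewrite mulr0 subrr.
have r0 : r = 0.
  (* If [r] had degree j < n, pairing it with [hermite R j] would give its leading coefficient times
     j! [L 1], yet both parts of [r] are orthogonal to degree j. *)
  apply/eqP; rewrite -size_poly_eq0; case Er : (size r) => [//|j].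
  have jn : (j < n)%N by rewrite -Er.
  have : L (hermite R j * r) = 0.
    rewrite mulrC mulrBl linearB /= -scalerAl linearZ /=.
    rewrite (@orth n) ?hermite_orthogonal //; first last.
    - exact: leq_trans (size_hermite_leq R j) jn.
    - apply: leq_trans (size_hermite_leq R j) _; lia.
    have /leq_sizeP -> // : (size (hermite R j) <= n)%N.
      exact: leq_trans (size_hermite_leq R j) jn.
    by rewrite !mul0r mulr0 subrr.
  rewrite hermite_orthogonal ?Er // => /eqP.
  rewrite !mulf_eq0 (gt_eqF L1) orbF pnatr_eq0.
  rewrite (gtn_eqF (fact_gt0 j)) orbF.
  have : lead_coef r != 0 by rewrite lead_coef_eq0 -size_poly_eq0 Er.
  by rewrite lead_coefE Er /= => /negPf ->.
have Ha : H n = a *: hermite R n by apply/eqP; rewrite -subr_eq0 -/r r0.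
(* Equal norms force a^2 = 1, and the sign of the leading coefficient selects a = 1. *)
have := nH n; rewrite Ha -scalerAl -scalerAr !linearZ /=.
rewrite hermite_orthogonal ?size_hermite_leq // coef_hermite => /eqP.
have N0 : 2 ^+ n * n`!%:R * L 1 != 0.
  by rewrite !mulf_neq0 ?gt_eqF // ?exprn_gt0 // ltr0n fact_gt0.
rewrite mulrA -[X in _ == X]mul1r (inj_eq (mulIf N0)) -expr2.
by rewrite pexprn_eq1 ?ltW //= => /eqP ->; rewrite scale1r.
Qed.

End Orthogonal.

(** * Products and moments for a functional obeying integration by parts against exp(-2 v^2) *)

Section DoubledWeight.
Variables (R : realFieldType) (M : {scalar {poly R}}).
Hypothesis Mderiv : forall p, M p^`() = M (4%:P * 'X * p).

(** The sum of (2 X p - p') q and p (2 X q - q') is 4 X (p q) - (p q)', which [M] annihilates. *)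
Lemma hermite_shift (m n : nat) :
  M (hermite R m.+1 * hermite R n) = - M (hermite R m * hermite R n.+1).
Proof.
rewrite /=; set p := hermite R m; set q := hermite R n.
have -> : (2%:P * 'X * p - p^`()) * q =
  4%:P * 'X * (p * q) - (p * q)^`() - p * (2%:P * 'X * q - q^`()).
  by rewrite derivM !polyC_natr; ring.
by rewrite linearB linearB /= Mderiv subrr add0r.
Qed.

Lemma hermite_shiftn (m n : nat) :
  M (hermite R m * hermite R n) = (-1) ^+ m * M (hermite R (m + n)).
Proof.
elim: m n => [|m IH] n; first by rewrite mul1r expr0 mul1r.
by rewrite hermite_shift IH addnS addSn exprS !mulNr mul1r.
Qed.

(** Split 2 X h - h' as half of 4 X h - h', annihilated by [M], minus half of h'; for h = h_{n+1}
    the latter is (n+1) h_n. *)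
Lemma moment_hermiteSS (n : nat) : M (hermite R n.+2) = - n.+1%:R * M (hermite R n).
Proof.
have -> : hermite R n.+2 =
  2^-1 *: (4%:P * 'X * hermite R n.+1 - (hermite R n.+1)^`())
  - 2^-1 *: (hermite R n.+1)^`().
  have -> : hermite R n.+2 = 2%:P * 'X * hermite R n.+1 - (hermite R n.+1)^`() by [].
  rewrite -!mul_polyC; have : (2^-1)%:P * 2%:P = 1 :> {poly R}.
    by rewrite -polyCM mulVf // pnatr_eq0.
  rewrite !polyC_natr; set h := (2^-1)%:P; set x := hermite _ _; set y := deriv _.
  move=> e; have e4 : h * 4 = 2 by rewrite (_ : 4 = 2 * 2) ?mulrA ?e ?mul1r // -natrM.
  have -> : h * (4 * 'X * x - y) = (h * 4) * 'X * x - h * y by ring.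
  rewrite e4 -[in LHS](mul1r y) -e; ring.
have MZ a p : M (a *: p) = a * M p by exact: linearZ.
(* [Mderiv] rewrites both occurrences of the derivative; [-Mderiv] restores the one that
   survives. *)
rewrite linearB !MZ linearB Mderiv subrr mulr0 sub0r -Mderiv.
by rewrite deriv_hermiteS MZ natrM; field.
Qed.

Lemma moment_hermite_odd (n : nat) : odd n -> M (hermite R n) = 0.
Proof.
elim/ltn_ind: n => -[|[|n]] // IH hn; last first.
  by rewrite moment_hermiteSS IH ?mulr0 //; move: hn; rewrite /= negbK.
have -> : hermite R 1 = 2^-1 *: (4%:P * 'X * 1 - 1^`()) + 2^-1 *: 1^`().
  rewrite /= !mulr1 derivC !subr0 scaler0 addr0 -mul_polyC mulrA -polyCM.
  by congr (_%:P * _); field.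
by rewrite linearD !linearZ linearB /= Mderiv subrr mulr0 add0r -Mderiv derivC linear0 mulr0.
Qed.

(** Iterating the two-step recurrence produces (-1)^k (2k-1)!!, written here as (2k)! / (2^k k!). *)
Lemma moment_hermite_even (k : nat) :
  M (hermite R k.*2) = (-1) ^+ k * (k.*2)`!%:R / (2 ^+ k * k`!%:R) * M 1.
Proof.
elim: k => [|k IH]; first by rewrite expr0 fact0 !mulr1 divr1 mul1r.
rewrite doubleS moment_hermiteSS IH !factS !natrM !exprS -!muln2.
have f0 : k`!%:R != 0 :> R by rewrite pnatr_eq0 -lt0n fact_gt0.
have e0 : 2 ^+ k != 0 :> R by rewrite expf_neq0 // pnatr_eq0.
have s0 : k.+1%:R != 0 :> R by rewrite pnatr_eq0.
have -> : (k * 2).+2%:R = 2 * k.+1%:R :> R by rewrite -natrM; congr _%:R; lia.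
field.
by rewrite f0 e0 -(natrD _ 1) s0.
Qed.

End DoubledWeight.

(** * Polynomials times Gaussians: growth, integrability, integration by parts *)

Section GaussianMoments.
Local Open Scope classical_set_scope.
Local Open Scope ring_scope.
Variable R : realType.
Local Notation mu := (@lebesgue_measure R).

(** Induction on p with the rate halved: one half bounds p, the other absorbs the new factor through
    |v| <= 1 + v^2. *)
Lemma horner_le_expR (p : {poly R}) (d : R) :
  0 < d -> exists C, forall v, `|p.[v]| <= C * expR (d * v ^+ 2).
Proof.
elim/poly_ind: p d => [|p a IH] d d0.
  by exists 0 => v; rewrite horner0 normr0 mul0r.
have d2 : 0 < d / 2 by rewrite divr_gt0.
have [C HC] := IH _ d2.
have C0 : 0 <= C by have := HC 0; rewrite expr0n mulr0 expR0 mulr1; exact: le_trans.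
exists (C * (1 + (d / 2)^-1) + `|a|) => v.
rewrite hornerMXaddC (le_trans (ler_normD _ _)) // mulrDl lerD //; last first.
  by rewrite ler_peMr // -[leLHS]expR0 ler_expR mulr_ge0 ?sqr_ge0 ?ltW.
have -> : d * v ^+ 2 = d / 2 * v ^+ 2 + d / 2 * v ^+ 2 by field.
rewrite expRD mulrACA normrM ler_pM ?HC //.
have h1 := expR_ge1Dx (d / 2 * v ^+ 2).
have h2 : `|v| <= 1 + v ^+ 2.
  by rewrite -(real_normK (num_real v)); have := sqr_ge0 (`|v| - 2^-1); nra.
have E1 : 1 <= expR (d / 2 * v ^+ 2).
  by rewrite -[leLHS]expR0 ler_expR mulr_ge0 ?sqr_ge0 ?ltW.
apply: (le_trans h2); rewrite mulrDl mul1r lerD //.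
by rewrite ler_pdivlMl //; lra.
Qed.

Definition gaussw (c : R) (p : {poly R}) (v : R) : R := p.[v] * expR (- c * v ^+ 2).

Lemma is_derive_gaussw c p (x : R) :
  is_derive x 1 (gaussw c p) (gaussw c (p^`() - (2 * c)%:P * 'X * p) x).
Proof.
rewrite /gaussw.
have h : is_derive x 1 (fun v : R => expR (- c * v ^+ 2))
   (- (2 * c) * x * expR (- c * x ^+ 2)).
  have -> : (fun v : R => expR (- c * v ^+ 2)) = expR \o horner (- c *: 'X^2).
    by apply/funext => v; rewrite /= !hornerE.
  have H := is_derive1_comp (is_derive_expR _) (is_derive_poly (- c *: 'X^2) x).
  apply: is_derive_eq H _.
  rewrite hornerZ hornerXn; move: (expR _) => e.
  by rewrite derivZ derivXn !hornerE /=; ring.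
have := is_deriveM (is_derive_poly p x) h.
move=> H; apply: is_derive_eq H _.
move: (expR _) => e; rewrite !hornerE /= /GRing.scale /=; ring.
Qed.

Lemma continuous_gaussw c p : continuous (gaussw c p).
Proof.
move=> x; apply/differentiable_continuous/derivable1_diffP.
by have [] := is_derive_gaussw c p x.
Qed.

Lemma measurable_gaussw c p : measurable_fun setT (gaussw c p).
Proof. by apply: continuous_measurable_fun; exact: continuous_gaussw. Qed.

(** Up to its peak value this is the centred normal density of variance 1/(2c), whose total mass is
    1. *)
Lemma integral_gaussw1 c : 0 < c ->
  mu.-integrable setT (EFin \o gaussw c 1) /\
  (\int[mu]_v gaussw c 1 v)%R = Num.sqrt (pi / c).
Proof.
move=> c0; pose s := (Num.sqrt (c *+ 2))^-1.
have s0 : s != 0 by rewrite invr_eq0 gt_eqF // sqrtr_gt0 mulrn_wgt0.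
have s2 : s ^+ 2 = (c *+ 2)^-1 by rewrite exprVn sqr_sqrtr // mulrn_wge0 // ltW.
have E : gaussw c 1 = fun x => (normal_peak s)^-1 * normal_pdf 0 s x.
  apply/funext => v; rewrite normal_pdfE // mulKf ?gt_eqF ?normal_peak_gt0 //.
  rewrite /normal_fun /gaussw hornerC mul1r subr0 s2; congr expR.
  by field; rewrite gt_eqF.
have i1 := integrable_normal_pdf 0 s.
split.
  rewrite E; have := integrableZl measurableT (normal_peak s)^-1 i1.
  by apply: eq_integrable => // x _.
rewrite E RintegralZl // /Rintegral integral_normal_pdf mulr1 invrK s2.
by congr Num.sqrt; field; rewrite gt_eqF.
Qed.

(** Bounding p at rate c/2 spends half of the decay and leaves an integrable Gaussian of rate
    c/2. *)
Lemma integrable_gaussw c p : 0 < c -> mu.-integrable setT (EFin \o gaussw c p).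
Proof.
move=> c0; have c2 : 0 < c / 2 by rewrite divr_gt0.
have [C HC] := horner_le_expR p c2.
have := integrableZl measurableT C (integral_gaussw1 c2).1.
apply: le_integrable => //.
  by apply/measurable_EFinP; exact: measurable_gaussw.
move=> v _; rewrite /= lee_fin normrM [X in _ * X]ger0_norm ?expR_ge0 //.
apply: le_trans (ler_norm _).
have -> : - c * v ^+ 2 = c / 2 * v ^+ 2 * -1 + - (c / 2) * v ^+ 2 by field.
rewrite expRD mulrA /gaussw hornerC mul1r ler_pM2r ?expR_gt0 //.
by rewrite mulrN1 expRN ler_pdivrMr ?expR_gt0.
Qed.

(** The growth bound applied to [p * 'X] yields decay like 1/|v|, enough to remove boundary
    terms. *)
Lemma gaussw_le c p : 0 < c -> exists C, forall v, `|gaussw c p v| * `|v| <= C.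
Proof.
move=> c0; have [C HC] := horner_le_expR (p * 'X) c0.
exists C => v; have := HC v; rewrite hornerMX normrM.
rewrite /gaussw mulNr expRN normrM [X in _ * X * _]ger0_norm ?invr_ge0 ?expR_ge0 //.
by rewrite mulrAC ler_pdivrMr ?expR_gt0.
Qed.

Lemma cvg_gaussw c p (u : nat -> R) : 0 < c ->
  (forall n, n.+1%:R <= `|u n|) -> gaussw c p (u n) @[n --> \oo] --> (0 : R).
Proof.
move=> c0 un; have [C HC] := gaussw_le p c0.
have C0 : 0 <= C by apply: le_trans (HC 0); rewrite mulr_ge0.
apply: norm_cvg0; apply: (@squeeze_cvgr _ _ _ _ (cst 0) (fun n => C * harmonic n)).
- apply: nearW => n; rewrite normr_ge0 /= ler_pdivlMr ?ltr0n //.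
  by apply: le_trans (HC (u n)); rewrite ler_wpM2l.
- exact: cvg_cst.
- by rewrite -[X in _ --> X](mulr0 C); apply: cvgM; [exact: cvg_cst|exact: cvg_harmonic].
Qed.

(** The integrand is the derivative of [gaussw c p]: its integrals over growing intervals are
    boundary terms tending to 0, and dominated convergence passes to the whole line. This supplies
    [Lderiv] and [Mderiv]. *)
Lemma integral_deriv_gaussw c p : 0 < c ->
  (\int[mu]_v gaussw c (p^`() - (2 * c)%:P * 'X * p) v)%R = 0.
Proof.
move=> c0; set q := p^`() - _.
(* The endpoint n+1 keeps the interval nondegenerate at n = 0. *)
pose D (n : nat) : set R := `[- n.+1%:R, n.+1%:R]%classic.
have FTC n : (\int[mu]_(x in D n) (gaussw c q x)%:E =
    (gaussw c p n.+1%:R)%:E - (gaussw c p (- n.+1%:R))%:E)%E.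
  apply: continuous_FTC2.
  - by rewrite gtrN // ltr0n.
  - exact/continuous_subspaceT/continuous_gaussw.
  - split; first by move=> x _; have [] := is_derive_gaussw c p x.
    + exact/cvg_at_right_filter/continuous_gaussw.
    + exact/cvg_at_left_filter/continuous_gaussw.
  - by move=> x _; rewrite derive1E; apply: derive_val; exact: is_derive_gaussw.
have iq := integrable_gaussw q c0.
pose f_ n := (EFin \o gaussw c q) \_ (D n).
have [|||||_ _ cvg1] := @dominated_convergence _ _ _ mu setT measurableT f_
  (EFin \o gaussw c q) (abse \o (EFin \o gaussw c q)).
- move=> n; apply/measurable_restrict => //; rewrite ?setTI //; first exact: measurable_itv.
  by apply: measurable_funTS; apply/measurable_EFinP; exact: measurable_gaussw.
- by apply/measurable_EFinP; exact: measurable_gaussw.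
(* Once n reaches the integer part of |x|, the interval contains x and the truncation is constant
   there. *)
- apply: aeW => x _; apply: cvg_near_cst.
  exists (Num.truncn `|x|) => // n /= hn; rewrite /f_ patchE mem_set //.
  rewrite /D /= in_itv /= -ler_norml.
  apply: le_trans (ltW (truncnS_gt _)) _.
  by rewrite ler_nat ltnS.
- exact: integrable_abse.
- apply: aeW => x n _; rewrite /f_ patchE /=; case: ifP => // _.
  by rewrite abse0 lee_fin.
have cvg0 : (\int[mu]_x f_ n x)%E @[n --> \oo] --> 0%E.
  rewrite (_ : (fun n => _) = fun n => (gaussw c p n.+1%:R - gaussw c p (- n.+1%:R))%:E).
    apply: cvg_EFin; first exact: nearW.
    rewrite -[X in _ --> X](subrr 0); apply: cvgB; apply: cvg_gaussw => // n.
      by rewrite ger0_norm.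
    by rewrite normrN ger0_norm.
  by apply/funext => n; rewrite -integral_mkcond FTC.
by rewrite /Rintegral (cvg_unique _ cvg1 cvg0).
Qed.

Lemma Rintegral_gaussw_linear c : 0 < c -> scalar (fun p => (\int[mu]_v gaussw c p v)%R).
Proof.
move=> c0 a p q; rewrite -RintegralZl //; last exact: integrable_gaussw.
rewrite -RintegralD //; [| |exact: integrable_gaussw].
  by apply: eq_Rintegral => v _; rewrite /gaussw hornerD hornerZ; ring.
have := integrableZl measurableT a (integrable_gaussw p c0).
by apply: eq_integrable => // x _.
Qed.

End GaussianMoments.

(** * Identification of [H] and reduction of the Gram integral to a functional on polynomials *)

Section Gram.
Variable R : realType.
Local Notation mu := (@lebesgue_measure R).

Lemma is_hermiteE (H : nat -> {poly R}) : is_hermite H -> H =1 hermite R.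
Proof.
move=> [sH lH iH]; pose l p := (\int[mu]_v gaussw 1 p v)%R.
pose L : {scalar {poly R}} :=
  HB.pack l (GRing.isLinear.Build R {poly R} R *%R l (Rintegral_gaussw_linear ltr01)).
have LE n m : L (H n * H m) = if n == m then Num.sqrt pi * 2 ^+ m * m`!%:R else 0.
  rewrite -[RHS]/(fine _%:E) -iH /= /l /Rintegral; congr fine.
  by apply: eq_integral => v _; rewrite /gaussw hornerM mulN1r.
have L1 : L 1 = Num.sqrt pi by rewrite /= /l (integral_gaussw1 ltr01).2 divr1.
apply: (@hermite_unique R L) => //.
- move=> p; apply/eqP; rewrite -subr_eq0 -linearB /=; apply/eqP.
  by have := integral_deriv_gaussw p (@ltr01 R); rewrite mulr1.
- by rewrite L1 sqrtr_gt0 pi_gt0.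
- by move=> n m /negPf nm; rewrite LE nm.
- by move=> n; rewrite LE eqxx L1; ring.
Qed.

Lemma psi_product_integral (p q : {poly R}) (T : R) (a b : R) : 0 < T ->
  (\int[mu]_v (a * p.[v / Num.sqrt T] * expR (- (v ^+ 2 / T)) *
    (b * q.[v / Num.sqrt T] * expR (- (v ^+ 2 / T))))%:E)%E =
  (a * b * \int[mu]_v gaussw (2 / T) ((p * q) \Po ((Num.sqrt T)^-1 *: 'X)) v)%:E.
Proof.
move=> T0; have c0 : 0 < 2 / T by rewrite divr_gt0.
set r := _ \Po _; have ir := integrable_gaussw r c0.
rewrite -RintegralZl // /Rintegral fineK; last first.
  apply: integrable_fin_num => //.
  by have := integrableZl measurableT (a * b) ir; apply: eq_integrable => // v _.
apply: eq_integral => v _; congr EFin.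
rewrite /gaussw /r horner_comp hornerM hornerZ hornerX (mulrC _ v).
have -> : - (2 / T) * v ^+ 2 = - (v ^+ 2 / T) + - (v ^+ 2 / T).
  by field; rewrite gt_eqF.
by rewrite expRD; ring.
Qed.

(** The witness sends p to the integral of p(v / sqrt T) exp(-2 v^2 / T); rescaling the polynomial
    instead of v avoids a change of variables. *)
Lemma gramE (H : nat -> {poly R}) (T : R) (m n : nat) : is_hermite H -> 0 < T ->
  exists M : {scalar {poly R}},
  [/\ forall p, M p^`() = M (4%:P * 'X * p),
      M 1 = Num.sqrt (pi * T) / Num.sqrt 2 &
      gram H T m n =
      ((Num.sqrt (2 ^+ (m + n)) * Num.sqrt (m`!%:R * n`!%:R) * Num.sqrt (pi * T))^-1 *
       M (hermite R m * hermite R n))%:E].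
Proof.
move=> hH T0; set s := Num.sqrt T.
have s0 : s != 0 by rewrite gt_eqF // sqrtr_gt0.
have s2 : s ^+ 2 = T by rewrite sqr_sqrtr // ltW.
have c0 : 0 < 2 / T by rewrite divr_gt0.
have l0 := Rintegral_gaussw_linear c0.
pose l p := (\int[mu]_v gaussw (2 / T) (p \Po (s^-1 *: 'X)) v)%R.
have lin : scalar l.
  by move=> a p q; rewrite /l comp_polyD comp_polyZ l0.
pose M : {scalar {poly R}} := HB.pack l (GRing.isLinear.Build R {poly R} R *%R l lin).
pose L : {scalar {poly R}} := HB.pack (fun p => (\int[mu]_v gaussw (2 / T) p v)%R)
  (GRing.isLinear.Build R {poly R} R *%R _ l0).
exists M; split.
- have LD r : L r^`() = L ((2 * (2 / T))%:P * 'X * r).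
    apply/eqP; rewrite -subr_eq0 -linearB; apply/eqP.
    exact: integral_deriv_gaussw.
  move=> p; set q := s^-1 *: 'X.
  (* The chain rule and the rate 2/T both leave a factor 1 / sqrt T; cancelling it gives the
     constant 4 for every T. *)
  have := LD (p \Po q); rewrite deriv_comp.
  have -> : q^`() = (s^-1)%:P by rewrite derivZ derivX alg_polyC.
  have -> : (2 * (2 / T))%:P * 'X * (p \Po q) =
      s^-1 *: ((4%:P * 'X * p) \Po q).
    rewrite !comp_polyM comp_polyC comp_polyX /q -!mul_polyC.
    rewrite -[T]s2 !mulrA -!polyCM; congr (_%:P * _ * _).
    by field.
  rewrite (mulrC _ (s^-1)%:P) (mul_polyC s^-1) !linearZ => e; exact: (mulfI (invr_neq0 s0) e).
- rewrite /= /l comp_polyC (integral_gaussw1 c0).2 -sqrtrV ?ler0n // -sqrtrM.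
    by congr Num.sqrt; field; rewrite gt_eqF.
  by rewrite mulr_ge0 ?pi_ge0 ?ltW.
rewrite /gram /psi psi_product_integral // -/s !(is_hermiteE hH).
congr (_ * _)%:E; rewrite !powRN !powR12_sqrt; last 2 first.
- by rewrite !mulr_ge0 ?exprn_ge0 ?sqrtr_ge0.
- by rewrite !mulr_ge0 ?exprn_ge0 ?sqrtr_ge0.
rewrite -invfM; congr (_^-1).
(* [P] sits under both normalising roots, so the outer [P] is rewritten as the root of its
   square. *)
set P := Num.sqrt (pi * T); have P0 : 0 <= P by rewrite sqrtr_ge0.
rewrite exprD -[in RHS](ger0_norm P0) -sqrtr_sqr -!sqrtrM ?mulr_ge0 ?exprn_ge0 ?ler0n //.
by congr Num.sqrt; ring.
Qed.

End Gram.

Theorem proposition3p2 (R : realType) (H : nat -> {poly R})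
    (hH : is_hermite H) (T : R) (hT : 0 < T) (m n : nat) :
  (odd (m + n) -> gram H T m n = 0%:E) /\
  (~~ odd (m + n) ->
    gram H T m n =
    ((-1) ^ ((m%:Z - n%:Z) %/ 2)%Z * 2 `^ (- (m + n)%:R - 2^-1) *
     ((m + n)`!%:R / (((m + n)./2)`!%:R * Num.sqrt (m`!%:R * n`!%:R))))%:E).
Proof.
have [M [dM M1 ->]] := gramE m n hH hT.
rewrite (hermite_shiftn dM); split=> mn; first by rewrite (moment_hermite_odd dM) ?mulr0.
have [k kE] : exists k, (m + n = k.*2)%N.
  by exists (m + n)./2; rewrite -[LHS]odd_double_half (negPf mn).
rewrite kE (moment_hermite_even dM) M1 doubleK; congr EFin.
(* With m + n = 2k the division is exact, and (-1)^(m-k) = (-1)^m (-1)^k matches the signs from the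
   shift and the even moment. *)
have -> : ((m%:Z - n%:Z) %/ 2)%Z = m%:Z - k%:Z.
  have -> : m%:Z - n%:Z = (m%:Z - k%:Z) * 2 by lia.
  by rewrite mulzK.
rewrite expfzDr ?oppr_eq0 ?oner_eq0 // -invr_expz -!exprnP invr_sign.
(* The power of 2 collects 2^-k from the normalisation, 2^-k from the moment and 1 / sqrt 2 from
   [M 1]; sqrt (pi T) cancels. *)
rewrite powRD ?pnatr_eq0 ?implybT // !powRN powR12_sqrt // powR_mulrn //.
rewrite -[in Num.sqrt (2 ^+ _)]muln2 exprM sqrtr_sqr ger0_norm ?exprn_ge0 //.
rewrite -addnn exprD.
have P0 : Num.sqrt (pi * T) != 0 by rewrite gt_eqF // sqrtr_gt0 mulr_gt0 ?pi_gt0.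
have F0 : Num.sqrt (m`!%:R * n`!%:R) != 0 :> R.
  by rewrite gt_eqF // sqrtr_gt0 mulr_gt0 // ltr0n fact_gt0.
have Q0 : Num.sqrt 2 != 0 :> R by rewrite gt_eqF // sqrtr_gt0.
have k0 : k`!%:R != 0 :> R by rewrite pnatr_eq0 -lt0n fact_gt0.
have e0 : 2 ^+ k != 0 :> R by rewrite expf_neq0 // pnatr_eq0.
field.
by rewrite P0 F0 Q0 k0 e0.
Qed.
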